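(* Let $\Lambda=\mathrm{diag}(\lambda_1,\dots,\lambda_n)$ be a traceless real diagonal matrix. Then there is a unique factorization, depending smoothly on parameters, $$\mathrm{SO}_\Lambda\, \mathrm{L}^\Lambda\, \mathrm{U}\subset \mathrm{SL}(n,\mathbb{R}),$$ valid for those matrices $X\in\mathrm{SL}(n,\mathbb{R})$ in the complement of the solution set of a polynomial equation in the entries of $X$. That is, the product map $$\mathrm{SO}_\Lambda\times\mathrm{L}^\Lambda\times\mathrm{U}\to\mathrm{SL}(n,\mathbb{R}),\qquad (Q,L,U)\mapsto QLU,$$ is a diffeomorphism onto its image, which is open in $\mathrm{SL}(n,\mathbb{R})$, and there exists a real polynomial $p$ in the entries of an $n\times n$ matrix such that this image equals $\{X\in\mathrm{SL}(n,\mathbb{R})\mid p(X)\neq 0\}$.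
   Context: All matrices are real of size $n\times n$. Given $\Lambda=\mathrm{diag}(\lambda_1,\dots,\lambda_n)$ (repeated eigenvalues allowed, in arbitrary positions): - $\mathrm{SO}_\Lambda=\{Q\in \mathrm{SO}(n)\mid Q^T\Lambda Q=\Lambda\}$ is the group of special orthogonal matrices commuting with $\Lambda$. - $\mathrm{L}^\Lambda$ is the set of unit lower triangular matrices $L$ (lower triangular with all diagonal entries $1$) such that $L_{ij}=0$ whenever $\lambda_i=\lambda_j$ and $i\neq j$; it is an affine space, in general not a group. - $\mathrm{U}\subset\mathrm{SL}(n,\mathbb{R})$ is the group of determinant one upper triangular matrices with positive diagonal entries. A ''unique factorization depending smoothly on parameters'' means that the factors are embedded submanifolds and that the product map of the factors is a diffeomorphism onto its image, which is an open subset of the ambient group. *)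

(* Defs.v *)
From HB Require Import structures.
From mathcomp Require Import all_boot all_order all_algebra.
From mathcomp Require Import all_classical all_reals all_analysis.
(* mpoly is not imported: its notations clash with those of mathcomp-analysis. *)
From mathcomp.multinomials Require mpoly.

Set Implicit Arguments.
Unset Strict Implicit.
Unset Printing Implicit Defensive.

Import Order.TTheory GRing.Theory Num.Theory.
Import numFieldNormedType.Exports.

Local Open Scope classical_set_scope.
Local Open Scope ring_scope.

(* All normed spaces below are finite-dimensional in use: matrices, row vectors
   and products of these.  There [Ck k O f], for O open, is the usual class C^k
   on O: f is k times differentiable and its derivatives
   x |-> 'd f x v, iterated, are continuous. *)
Fixpoint Ck (R : realType) (V W : normedModType R) (k : nat) (O : set V)
    (f : V -> W) : Prop :=
  if k is k'.+1 then
    (forall x, O x -> differentiable f x) /\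
    (forall v, Ck k' O (fun x => 'd f x v))
  else forall x, O x -> {for x, continuous f}.

(* Smoothness on an arbitrary subset A: f has, near each point of A, a C^oo
   extension to an open subset of V.  On embedded submanifolds this is
   smoothness for the induced differentiable structure.  Only the values of f
   on A matter. *)
Definition smooth_on (R : realType) (V W : normedModType R) (A : set V)
    (f : V -> W) : Prop :=
  forall x, A x -> exists (O : set V) (g : V -> W),
    [/\ open O, O x, (forall k, Ck k O g) &
        (forall y, O y -> A y -> g y = f y)].

Definition diffeomorphism (R : realType) (V W : normedModType R)
    (A : set V) (B : set W) (f : V -> W) : Prop :=
  f @` A = B /\
  exists g : W -> V,
    [/\ (forall x, A x -> g (f x) = x), smooth_on A f & smooth_on B g].

Definition relatively_open (T : topologicalType) (M A : set T) : Prop :=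
  exists2 O : set T, open O & A = M `&` O.

(* The slice R^d x 0 of R^m. *)
Definition slice (R : realType) (m d : nat) : set 'rV[R]_m :=
  [set v | forall i : 'I_m, (d <= i)%N -> v 0 i = 0].

(* S is a d-dimensional embedded submanifold of the m-dimensional manifold M
   (itself a subset of the normed space V): around each point of S there is a
   chart phi of M, defined on M `&` O, which maps S to a slice. *)
Definition embedded_submanifold (R : realType) (V : normedModType R)
    (M S : set V) : Prop :=
  S `<=` M /\
  exists m d : nat, (d <= m)%N /\
  forall x, S x -> exists (O : set V) (phi : V -> 'rV[R]_m),
    [/\ open O, O x, open (phi @` (M `&` O)),
        diffeomorphism (M `&` O) (phi @` (M `&` O)) phi &
        phi @` (S `&` O) = phi @` (M `&` O) `&` slice d].

Definition SL (R : realType) (n : nat) : set 'M[R]_n :=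
  [set X | \det X = 1].

Definition SO (R : realType) (n : nat) : set 'M[R]_n :=
  [set Q | Q^T *m Q = 1%:M /\ \det Q = 1].

Definition SO_diag (R : realType) (n : nat) (lam : 'rV[R]_n) : set 'M[R]_n :=
  [set Q | SO Q /\ Q^T *m diag_mx lam *m Q = diag_mx lam].

(* [is_trig_mx] means lower triangular. *)
Definition L_diag (R : realType) (n : nat) (lam : 'rV[R]_n) : set 'M[R]_n :=
  [set L | [/\ is_trig_mx L, (forall i, L i i = 1) &
    (forall i j, lam 0 i = lam 0 j -> i != j -> L i j = 0)]].

Definition U_pos (R : realType) (n : nat) : set 'M[R]_n :=
  [set U | [/\ is_trig_mx U^T, (forall i, 0 < U i i) & \det U = 1]].

Definition prod3 (R : realType) (n : nat)
    (q : 'M[R]_n * 'M[R]_n * 'M[R]_n) : 'M[R]_n :=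
  q.1.1 *m q.1.2 *m q.2.

(* A polynomial in n * n variables, evaluated at the entries of X. *)
Definition entries_eval (R : realType) (n : nat) (p : mpoly.mpoly (n * n) R)
    (X : 'M[R]_n) : R :=
  mpoly.meval (fun k => mxvec X 0 k) p.

(* Main.v *)
(** Write i ~ j for lambda_i = lambda_j.  If X = Q L U, the columns v_i of
    V = Q L satisfy sum_(r ~ i) V_ri V_rk = delta_ik for i <= k, and Q is V with
    the entries r, i such that r is not ~ i replaced by 0.  Hence V is obtained
    from X by a Gram-Schmidt process for these partial inner products: the
    division-free elimination [elim] produces from X a matrix W, with polynomial
    entries, whose columns are positive multiples of those of V.  Conversely, if
    no pivot sum_(r ~ i) W_ri ^ 2 vanishes, normalising the columns of W yields
    V, hence a factorization of X, with factors depending smoothly on X.  The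
    product of the pivots is the polynomial.

    A single family of charts of SL(n) shows that the three factors are
    submanifolds: to X = Q L U it associates the Cayley transform of Q0^T Q, the
    free entries of L, and those of U; each factor is a slice. *)

Require Import Defs.
From HB Require Import structures.
From mathcomp Require Import all_boot all_order all_algebra ring.
From mathcomp Require Import all_classical all_reals all_analysis.
From mathcomp.multinomials Require mpoly.

Import Order.TTheory GRing.Theory Num.Theory.
Import numFieldNormedType.Exports.

Local Open Scope classical_set_scope.
Local Open Scope ring_scope.

Set Implicit Arguments.
Unset Strict Implicit.
Unset Printing Implicit Defensive.

(** * Smooth maps *)

Section Smoothness.
Context {R : realType}.
Implicit Types V W : normedModType R.

(** The zero map satisfies the first-order expansion that characterises the differential, since the
    increment of [h] vanishes identically near [x]. *)
Lemma is_diff_near0 V W (h : V -> W) x :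
  (\forall y \near x, h y = 0) -> is_diff x h 0.
Proof.
move=> h0.
have hx : h x = 0 by exact: nbhs_singleton h0.
have c0 : continuous (0 : V -> W) by move=> y; exact: cvg_cst.
have e0 : h \o shift x = cst (h x) + (0 : V -> W) +o_ 0 id.
  apply/eqaddoP => _/posnumP[e]; near=> y.
  rewrite /= !fctE hx add0r subr0.
  suff -> : h (y + x) = 0 by rewrite normr0 mulr_ge0.
  near: y; move: h0; rewrite (near_shift 0) subr0 => h0.
  by near=> z; exact: (near h0 z).
have d0 := @diff_unique _ _ _ h (\0 : {linear V -> W}) x c0 e0.
by apply: DiffDef => //; apply/diff_locallyP; rewrite d0; split.
Unshelve. all: by end_near. Qed.

Lemma is_diff_near V W (f g df : V -> W) x :
  (\forall y \near x, f y = g y) -> is_diff x f df -> is_diff x g df.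
Proof.
move=> fg dfx.
have dh : is_diff x (g - f) 0.
  by apply: is_diff_near0; near=> y; rewrite !fctE (near fg y)// subrr.
have -> : g = f + (g - f) by rewrite addrC subrK.
by rewrite -[df]addr0; exact: is_diffD.
Unshelve. all: by end_near. Qed.

Definition smooth V W (O : set V) (f : V -> W) := forall k, Ck k O f.

(** Continuity and the differential at a point depend only on the germ there. This lets the lemmas
    below replace ['d f x v] by the formula that a differentiation rule provides on [O] alone. *)
Lemma Ck_ext V W k (O : set V) (f g : V -> W) : open O ->
  (forall x, O x -> f x = g x) -> Ck k O f -> Ck k O g.
Proof.
move=> oO; elim: k f g => [|k IH] f g fg /=.
  move=> cf x Ox; rewrite /prop_for/continuous_at -fg//.
  apply: cvg_trans (cf x Ox); apply: near_eq_cvg.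
  near=> y; apply: fg; near: y; exact: open_nbhs_nbhs.
move=> [df Cdf].
have d x : O x -> is_diff x g ('d f x).
  move=> Ox; apply: (@is_diff_near _ _ f); last exact/differentiableP/df.
  near=> y; apply: fg; near: y; exact: open_nbhs_nbhs.
split=> [x Ox|v]; first by have [] := d _ Ox.
apply: IH (Cdf v) => x Ox; have dg := d x Ox.
by rewrite -[in LHS](diff_val (df := 'd f x)).
Unshelve. all: by end_near. Qed.

Lemma CkW V W k (O : set V) (f : V -> W) : Ck k.+1 O f -> Ck k O f.
Proof.
elim: k f => [|k IH] f [df Cdf].
  by move=> x Ox; apply: differentiable_continuous; exact: df.
by split=> // v; exact/IH/Cdf.
Qed.

Lemma Ck_cst V W k (O : set V) (a : W) : open O -> Ck k O (fun=> a).
Proof.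
move=> oO; elim: k a => [|k IH] a; first by move=> x _; exact: cvg_cst.
split=> [x _|v]; first exact: differentiable_cst.
by apply: Ck_ext (IH 0) => // x _; rewrite diff_cst.
Qed.

Lemma Ck_linear V W W' k (O : set V) (L : W -> W') (f : V -> W) :
  open O -> linear L -> continuous L -> Ck k O f -> Ck k O (L \o f).
Proof.
move=> oO linL cL.
pose LM := GRing.isLinear.Build _ _ _ _ _ linL.
pose LL : {linear W -> W'} := HB.pack L LM.
elim: k f => [|k IH] f /=.
  by move=> cf x Ox; apply: continuous_comp; [exact: cf|exact: cL].
have dL y : differentiable L y by exact: (@linear_differentiable _ _ _ LL).
move=> [df Cdf]; split=> [x Ox|v].
  by apply: differentiable_comp => //; exact: df.
apply: Ck_ext (IH _ (Cdf v)) => // x Ox.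
by rewrite diff_comp//=; [rewrite (@diff_lin _ _ _ LL)|exact: df].
Qed.

Lemma smooth_cst V W (O : set V) (a : W) : open O -> smooth O (fun=> a).
Proof. by move=> oO k; exact: Ck_cst. Qed.

Lemma smooth_linear V W W' (O : set V) (L : W -> W') (f : V -> W) :
  open O -> linear L -> continuous L -> smooth O f -> smooth O (L \o f).
Proof. by move=> oO lL cL sf k; exact: Ck_linear. Qed.

Lemma smooth_id V (O : set V) : open O -> smooth O (@id V).
Proof.
move=> oO [|k]; first by move=> x _; exact: cvg_id.
split=> [x _|v]; first exact: (@ex_diff _ _ _ _ _ _ _ (is_diff_id x)).
apply: Ck_ext (Ck_cst k v oO) => // x _.
by rewrite (@diff_val _ _ _ _ _ _ _ (is_diff_id x)).
Qed.

Lemma Ck_add V W k (O : set V) (f g : V -> W) : open O ->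
  Ck k O f -> Ck k O g -> Ck k O (fun x => f x + g x).
Proof.
move=> oO; elim: k f g => [|k IH] f g.
  by move=> cf cg x Ox; apply: cvgD; [exact: cf|exact: cg].
move=> [df Cf] [dg Cg]; split=> [x Ox|v].
  by apply: differentiableD; [exact: df|exact: dg].
apply: Ck_ext (IH _ _ (Cf v) (Cg v)) => // x Ox.
by have /(congr1 (@^~ v)) /= /esym := diffD (df _ Ox) (dg _ Ox); apply.
Qed.

Lemma smooth_add V W (O : set V) (f g : V -> W) : open O ->
  smooth O f -> smooth O g -> smooth O (fun x => f x + g x).
Proof. by move=> oO sf sg k; exact: Ck_add. Qed.

Lemma smooth_sum V W (O : set V) (I : Type) (r : seq I) (P : pred I)
    (f : I -> V -> W) : open O -> (forall i, P i -> smooth O (f i)) ->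
  smooth O (fun x => \sum_(i <- r | P i) f i x).
Proof.
move=> oO sf k; elim: r => [|i r IH].
  by apply: (Ck_ext oO _ (Ck_cst k 0 oO)) => x _; rewrite big_nil.
case: (boolP (P i)) => Pi; last first.
  by apply: Ck_ext IH => // x _; rewrite big_cons (negbTE Pi).
by apply: Ck_ext (Ck_add oO (sf i Pi k) IH) => // x _; rewrite big_cons Pi.
Qed.

(** Leibniz rule, by induction on the order: the undifferentiated factors are needed only at the
    lower order, through [CkW]. *)
Lemma Ck_mul V k (O : set V) (f g : V -> R) : open O ->
  Ck k O f -> Ck k O g -> Ck k O (fun x => f x * g x).
Proof.
move=> oO; elim: k f g => [|k IH] f g Cf Cg.
  by move=> x Ox; apply: cvgM; [exact: Cf|exact: Cg].
have [df dCf] := Cf; have [dg dCg] := Cg; split=> [x Ox|v].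
  by apply: differentiableM; [exact: df|exact: dg].
apply: Ck_ext (Ck_add oO (IH _ _ (CkW Cf) (dCg v))
                         (IH _ _ (CkW Cg) (dCf v))) => // x Ox.
by have /(congr1 (@^~ v)) /= /esym := diffM (df _ Ox) (dg _ Ox); apply.
Qed.

Lemma smooth_mul V (O : set V) (f g : V -> R) : open O ->
  smooth O f -> smooth O g -> smooth O (fun x => f x * g x).
Proof. by move=> oO sf sg k; exact: Ck_mul. Qed.

Lemma smooth_prod V (O : set V) (I : Type) (r : seq I) (P : pred I)
    (f : I -> V -> R) : open O -> (forall i, P i -> smooth O (f i)) ->
  smooth O (fun x => \prod_(i <- r | P i) f i x).
Proof.
move=> oO sf k; elim: r => [|i r IH].
  by apply: (Ck_ext oO _ (Ck_cst k (1 : R) oO)) => x _; rewrite big_nil.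
case: (boolP (P i)) => Pi; last first.
  by apply: Ck_ext IH => // x _; rewrite big_cons (negbTE Pi).
by apply: Ck_ext (Ck_mul oO (sf i Pi k) IH) => // x _; rewrite big_cons Pi.
Qed.

Lemma Ck_inv V k (O : set V) (f : V -> R) : open O ->
  (forall x, O x -> f x != 0) -> Ck k O f -> Ck k O (fun x => (f x)^-1).
Proof.
move=> oO f0; elim: k => [|k IH] Cf.
  by move=> x Ox; apply: cvgV; [exact: f0|exact: Cf].
have [df dCf] := Cf; split=> [x Ox|v].
  by apply: differentiableV; [exact: df|exact: f0].
(* The derivative of [1/f] is [-f'/f^2]; the induction hypothesis supplies [1/f] at order [k]. *)
have Ci := IH (CkW Cf).
have Ci2 := Ck_mul oO (Ck_cst k (-1 : R) oO) (Ck_mul oO Ci Ci).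
apply: Ck_ext (Ck_mul oO Ci2 (dCf v)) => // x Ox.
have /(congr1 (@^~ v)) /= /esym E := diffV (df _ Ox) (f0 _ Ox).
by apply: etrans E; rewrite mulN1r -expr2 exprVn.
Qed.

Lemma smooth_inv V (O : set V) (f : V -> R) : open O ->
  (forall x, O x -> f x != 0) -> smooth O f -> smooth O (fun x => (f x)^-1).
Proof. by move=> oO f0 sf k; exact: Ck_inv. Qed.

Lemma Ck_sqrt V k (O : set V) (f : V -> R) : open O ->
  (forall x, O x -> 0 < f x) -> Ck k O f -> Ck k O (fun x => Num.sqrt (f x)).
Proof.
move=> oO f0; elim: k => [|k IH] Cf.
  move=> x Ox; apply: (@continuous_comp _ _ _ f Num.sqrt); first exact: Cf.
  exact: sqrt_continuous.
have [df dCf] := Cf.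
have dsqrt (y : R) : 0 < y -> differentiable (Num.sqrt : R -> R) y.
  move=> y0; apply/derivable1_diffP.
  by have [] := is_derive1_sqrt y0.
split=> [x Ox|v].
  by apply: differentiable_comp; [exact: df|exact/dsqrt/f0].
(* The derivative of the root is [f'] times this factor, which is C^k by the induction
   hypothesis. *)
have Ci : Ck k O (fun x => (2 * Num.sqrt (f x))^-1).
  apply: Ck_inv => //.
    by move=> x Ox; rewrite mulf_neq0 ?pnatr_eq0// gt_eqF// sqrtr_gt0 f0.
  by apply: Ck_mul => //; [exact: Ck_cst|exact/IH/CkW].
apply: Ck_ext (Ck_mul oO (dCf v) Ci) => // x Ox.
have /(congr1 (@^~ v)) /= /esym := diff_comp (df _ Ox) (dsqrt _ (f0 _ Ox)).
apply: etrans.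
by rewrite diff1E; [rewrite derive1E derive_sqrt ?f0|exact/dsqrt/f0].
Qed.

Lemma smooth_sqrt V (O : set V) (f : V -> R) : open O ->
  (forall x, O x -> 0 < f x) -> smooth O f ->
  smooth O (fun x => Num.sqrt (f x)).
Proof. by move=> oO f0 sf k; exact: Ck_sqrt. Qed.

Lemma smooth_pair V W W' (O : set V) (f : V -> W) (g : V -> W') : open O ->
  smooth O f -> smooth O g -> smooth O (fun x => (f x, g x)).
Proof.
move=> oO sf sg k; move: (sf k) (sg k) => {sf sg}.
elim: k f g => [|k IH] f g.
  by move=> cf cg x Ox; apply: cvg_pair; [exact: cf|exact: cg].
move=> [df Cf] [dg Cg]; split=> [x Ox|v].
  by apply: differentiable_pair; [exact: df|exact: dg].
apply: Ck_ext (IH _ _ (Cf v) (Cg v)) => // x Ox.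
by have /(congr1 (@^~ v)) /= /esym := diff_pair (df _ Ox) (dg _ Ox); apply.
Qed.

Lemma smooth_fst V W W' (O : set V) (f : V -> W * W') : open O ->
  smooth O f -> smooth O (fun x => (f x).1).
Proof.
move=> oO; apply: (@smooth_linear _ _ _ O fst) => //.
by move=> x; exact: cvg_fst.
Qed.

Lemma smooth_snd V W W' (O : set V) (f : V -> W * W') : open O ->
  smooth O f -> smooth O (fun x => (f x).2).
Proof.
move=> oO; apply: (@smooth_linear _ _ _ O snd) => //.
by move=> x; exact: cvg_snd.
Qed.

Lemma smooth_coord V (O : set V) m n (F : V -> 'M[R]_(m, n)) i j : open O ->
  smooth O F -> smooth O (fun x => F x i j).
Proof.
move=> oO.
apply: (@smooth_linear _ _ _ O (fun M : 'M[R]_(m, n) => M i j)) => //.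
  by move=> a u v; rewrite !mxE.
exact: coord_continuous.
Qed.

Lemma smooth_mx V (O : set V) m n (F : V -> 'M[R]_(m, n)) : open O ->
  (forall i j, smooth O (fun x => F x i j)) -> smooth O F.
Proof.
move=> oO sF.
(* A matrix is the sum of its entries times elementary matrices, and each summand is a continuous
   linear image of one entry. *)
have S : smooth O
    (fun x => \sum_i \sum_j F x i j *: delta_mx i j : 'M[R]_(m, n)).
  apply: smooth_sum => // i _; apply: smooth_sum => // j _.
  apply: (@smooth_linear _ _ _ O
    (fun a : R => a *: (delta_mx i j : 'M[R]_(m, n)))) => //.
    by move=> a u v; rewrite scalerDl scalerA.
  exact: scalel_continuous.
by move=> k; apply: Ck_ext (S k) => // x _; rewrite -matrix_sum_delta.
Qed.

Lemma smooth_smooth_on V W (O A : set V) (f g : V -> W) :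
  open O -> A `<=` O -> smooth O g -> (forall x, A x -> g x = f x) ->
  smooth_on A f.
Proof.
move=> oO AO sg gf x Ax; exists O, g; split=> //; first exact: AO.
by move=> y _; exact: gf.
Qed.

End Smoothness.

(** * Smoothness of matrix operations *)

Section SmoothMatrices.
Context {R : realType} {V : normedModType R}.

Lemma smooth_sub (W : normedModType R) (A B : set V) (f : V -> W) :
  A `<=` B -> smooth B f -> smooth A f.
Proof.
move=> AB + k; move=> /(_ k); elim: k f => [|k IH] f.
  by move=> cf x /AB; exact: cf.
by move=> [df Cf]; split=> [x /AB|v]; [exact: df|exact/IH/Cf].
Qed.

Variable O : set V.
Hypothesis oO : open O.

(** The key stays arbitrary because products, transposes and adjugates are matrices locked under
    different keys. *)
Lemma smooth_matrix key m n (F : 'I_m -> 'I_n -> V -> R) :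
  (forall i j, smooth O (F i j)) ->
  smooth O (fun x => \matrix[key]_(i, j) F i j x : 'M[R]_(m, n)).
Proof.
move=> sF; apply: smooth_mx => // i j.
have -> : (fun x => (\matrix[key]_(i, j) F i j x : 'M[R]_(m, n)) i j) = F i j.
  by apply/funext => x; rewrite mxE.
exact: sF.
Qed.

Lemma smooth_mulmx m n p (F : V -> 'M[R]_(m, n)) (G : V -> 'M[R]_(n, p)) :
  smooth O F -> smooth O G -> smooth O (fun x => F x *m G x).
Proof.
move=> sF sG; apply: smooth_matrix => i j.
by apply: smooth_sum => // k _; apply: smooth_mul => //; exact: smooth_coord.
Qed.

Lemma smooth_trmx m n (F : V -> 'M[R]_(m, n)) :
  smooth O F -> smooth O (fun x => (F x)^T).
Proof. by move=> sF; apply: smooth_matrix => i j; exact: smooth_coord. Qed.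

Lemma smooth_det n (F : V -> 'M[R]_n) :
  smooth O F -> smooth O (fun x => \det (F x)).
Proof.
move=> sF; apply: smooth_sum => // s _; apply: smooth_mul => //.
  exact: smooth_cst.
by apply: smooth_prod => // i _; exact: smooth_coord.
Qed.

Lemma smooth_adj n (F : V -> 'M[R]_n) :
  smooth O F -> smooth O (fun x => \adj (F x)).
Proof.
move=> sF; apply: smooth_matrix => i j.
apply: smooth_mul => //; first exact: smooth_cst.
apply: smooth_det; apply: smooth_matrix => k l.
by apply: smooth_coord => //; apply: smooth_matrix => ? ?; exact: smooth_coord.
Qed.

Lemma smooth_invmx n (F : V -> 'M[R]_n) :
  (forall x, O x -> \det (F x) != 0) ->
  smooth O F -> smooth O (fun x => invmx (F x)).
Proof.
move=> dF sF k.
(* Cramer's formula; [invmx] agrees with it where the determinant is nonzero, hence on [O]. *)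
have S : smooth O (fun x => (((\det (F x))^-1)%:M : 'M[R]_n) *m \adj (F x)).
  apply: smooth_mulmx; last exact: smooth_adj.
  apply: smooth_matrix => i j; case: (i == j); last exact: smooth_cst.
  by apply: smooth_inv => //; exact: smooth_det.
apply: Ck_ext (S k) => // x Ox.
by rewrite mul_scalar_mx /invmx unitmxE unitfE dF.
Qed.

Lemma open_smooth_neq0 (f : V -> R) :
  smooth O f -> open [set x | O x /\ f x != 0].
Proof.
move=> sf; rewrite openE => x [Ox fx0]; have cf := sf 0%N x Ox.
rewrite /interior; near=> y; split.
  by near: y; exact: open_nbhs_nbhs.
near: y; apply: (cf [set z | z != 0]).
by apply: open_nbhs_nbhs; split; [exact: open_neq|exact: fx0].
Unshelve. all: by end_near. Qed.

End SmoothMatrices.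

(** * Polynomial functions of the entries of a matrix *)

Section PolynomialFunctions.
Import (canonicals, coercions) mpoly.
Context {R : realType} {n : nat}.
Implicit Types (f g : 'M[R]_n -> R).

Definition polynomial_fun f :=
  exists p : mpoly.mpoly (n * n) R, forall X, entries_eval p X = f X.

Lemma polynomial_cst (a : R) : polynomial_fun (fun=> a).
Proof. by exists (mpoly.mpolyC (n * n) a) => X; exact: mpoly.mevalC. Qed.

Lemma polynomial_coord i j : polynomial_fun (fun X => X i j).
Proof.
exists (mpoly.mpolyX _ (mpoly.mnm1 (mxvec_index i j))) => X.
by rewrite /entries_eval mpoly.mevalXU mxvecE.
Qed.

Lemma polynomial_add f g : polynomial_fun f -> polynomial_fun g ->
  polynomial_fun (fun X => f X + g X).
Proof.
move=> [p fp] [q gq]; exists (p + q) => X.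
by rewrite /entries_eval mpoly.mevalD -fp -gq.
Qed.

Lemma polynomial_mul f g : polynomial_fun f -> polynomial_fun g ->
  polynomial_fun (fun X => f X * g X).
Proof.
move=> [p fp] [q gq]; exists (p * q) => X.
by rewrite /entries_eval mpoly.mevalM -fp -gq.
Qed.

Lemma polynomial_sum (I : Type) (s : seq I) (P : pred I)
    (f : I -> 'M[R]_n -> R) :
  (forall i, polynomial_fun (f i)) ->
  polynomial_fun (fun X => \sum_(i <- s | P i) f i X).
Proof.
move=> pf; elim: s => [|i s [p IH]].
  have [p p0] := polynomial_cst 0.
  by exists p => X; rewrite big_nil p0.
have [Pi|Pi] := boolP (P i); last first.
  by exists p => X; rewrite big_cons (negbTE Pi) IH.
have [q fq] := pf i; exists (q + p) => X.
by rewrite /entries_eval mpoly.mevalD big_cons Pi -fq -IH.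
Qed.

Lemma polynomial_prod (I : Type) (s : seq I) (P : pred I)
    (f : I -> 'M[R]_n -> R) :
  (forall i, polynomial_fun (f i)) ->
  polynomial_fun (fun X => \prod_(i <- s | P i) f i X).
Proof.
move=> pf; elim: s => [|i s [p IH]].
  have [p p0] := polynomial_cst 1.
  by exists p => X; rewrite big_nil p0.
have [Pi|Pi] := boolP (P i); last first.
  by exists p => X; rewrite big_cons (negbTE Pi) IH.
have [q fq] := pf i; exists (q * p) => X.
by rewrite /entries_eval mpoly.mevalM big_cons Pi -fq -IH.
Qed.

Lemma smooth_polynomial (O : set 'M[R]_n) f :
  open O -> polynomial_fun f -> smooth O f.
Proof.
move=> oO [p pE].
have -> : f = fun X => \sum_(m <- mpoly.msupp p)
    mpoly.mcoeff m p * \prod_i \prod_(j < m i) mxvec X 0 i.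
  apply/funext => x; rewrite -pE /entries_eval mpoly.mevalE.
  apply: eq_bigr => m _; congr (_ * _); apply: eq_bigr => i _.
  by rewrite prodr_const card_ord.
apply: smooth_sum => // m _; apply: smooth_mul => //; first exact: smooth_cst.
apply: smooth_prod => // i _; apply: smooth_prod => // _ _.
case/mxvec_indexP: i => i j.
have -> : (fun X : 'M[R]_n => mxvec X 0 (mxvec_index i j)) = fun X => X i j.
  by apply/funext => X; rewrite mxvecE.
by apply: smooth_coord => //; exact: smooth_id.
Qed.

End PolynomialFunctions.

(** * Existence and uniqueness of the factorization *)

Section Elimination.
Context {R : realType} {n : nat}.
Variable lam : 'rV[R]_n.
Implicit Types (X Y S V : 'M[R]_n) (i j k l r : 'I_n).

Definition upper_pos S := is_trig_mx S^T /\ forall i, 0 < S i i.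

Lemma upper_posP S : upper_pos S <->
  (forall i j, (j < i)%N -> S i j = 0) /\ (forall i, 0 < S i i).
Proof.
split=> -[tS pS]; split=> //.
  by move=> i j ji; have /is_trig_mxP/(_ j i ji) := tS; rewrite mxE.
by apply/is_trig_mxP => i j ij; rewrite mxE tS.
Qed.

Lemma upper_pos_mul S T : upper_pos S -> upper_pos T -> upper_pos (S *m T).
Proof.
move=> /upper_posP[S0 Sp] /upper_posP[T0 Tp]; apply/upper_posP; split.
  move=> i j ji; rewrite mxE big1// => k _; have [ki|ik] := ltnP k i.
    by rewrite S0// mul0r.
  by rewrite T0 ?mulr0//; exact: leq_trans ji ik.
move=> i; rewrite mxE (bigD1 i)//= big1 ?addr0 ?mulr_gt0// => k ki.
have [ki'|ik] := ltnP k i; first by rewrite S0// mul0r.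
by rewrite T0 ?mulr0// ltn_neqAle eq_sym ki.
Qed.

Lemma upper_pos1 : upper_pos 1%:M.
Proof.
apply/upper_posP; split=> [i j ji|i]; rewrite !mxE ?eqxx//.
by rewrite -val_eqE /= gtn_eqF.
Qed.

Lemma det_upper_pos S : upper_pos S -> 0 < \det S.
Proof.
by move=> [tS pS]; rewrite -det_tr det_trig// prodr_gt0// => i _; rewrite mxE.
Qed.

(** The first index selects the class over which the sum runs, so this pairing of columns is not
    symmetric in general when [i] and [k] lie in different classes. *)
Definition gram Y i k := \sum_(r | lam 0 r == lam 0 i) Y r i * Y r k.

(** Makes the later columns orthogonal to column [i] over the class of [i]. Scaling by [gram Y i i]
    replaces the division of the usual projection and keeps the entries polynomial. *)
Definition elim_step i Y : 'M[R]_n := \matrix_(r, k)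
  if (i < k)%N then gram Y i i * Y r k - gram Y i k * Y r i else Y r k.

(** [insub] fails for [m'] outside the range of column indices, and such steps do nothing. *)
Fixpoint elim X (m : nat) : 'M[R]_n :=
  if m is m'.+1 then oapp (elim_step^~ (elim X m')) (elim X m') (insub m')
  else X.

Lemma elimS X i : elim X i.+1 = elim_step i (elim X i).
Proof. by rewrite /= valK. Qed.

Lemma gram_col Y Y' i k : (forall r, Y r i = Y' r i) ->
  (forall r, Y r k = Y' r k) -> gram Y i k = gram Y' i k.
Proof. by move=> Yi Yk; apply: eq_bigr => r _; rewrite Yi Yk. Qed.

(** Step [j] leaves the columns up to [j] fixed, and [gram] is linear in its second column. *)
Lemma gram_step Y j i k : (i <= j)%N -> gram (elim_step j Y) i k =
  if (j < k)%N then gram Y j j * gram Y i k - gram Y j k * gram Y i j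
  else gram Y i k.
Proof.
move=> ij; case: ifP => jk; last first.
  by apply: gram_col => r; rewrite mxE ?jk// ltnNge ij.
rewrite {1}/gram !mulr_sumr -sumrB; apply: eq_bigr => r _.
by rewrite !mxE jk ltnNge ij /=; ring.
Qed.

(** Column [k] is modified only by the steps of index below [k], hence is final after [k] steps. *)
Lemma elim_frozen X k m r : (k <= m)%N -> elim X m r k = elim X k r k.
Proof.
elim: m => [|m IH]; first by rewrite leqn0 => /eqP ->.
rewrite leq_eqVlt => /orP[/eqP -> //|]; rewrite ltnS => km.
rewrite /=; case: insubP => [i _ im|_] /=; last exact: IH.
by rewrite mxE im ltnNge km /= IH.
Qed.

Lemma gram_elim_frozen X i m : (i <= m)%N ->
  gram (elim X m) i i = gram (elim X i) i i.
Proof. by move=> im; apply: gram_col => r; rewrite elim_frozen. Qed.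

(** Step [i] creates the orthogonality. A later step [j] replaces column [k], if at all, by a
    combination of columns [k] and [j], both already orthogonal to column [i]. *)
Lemma gram_elim0 X m i k : (i < m)%N -> (i < k)%N -> gram (elim X m) i k = 0.
Proof.
move=> + ik; elim: m k ik => // m IH k ik; rewrite ltnS leq_eqVlt => /orP[|im].
  move=> /eqP E; subst m; rewrite elimS (gram_step _ _ (leqnn i)) ik.
  by rewrite mulrC subrr.
rewrite /=; case: insubP => [j _ jm|_] /=; last exact: IH.
have {}jm : j = m :> nat := jm.
rewrite gram_step ?jm; last exact: ltnW.
case: ifP => mk; last exact: IH.
by rewrite !IH ?jm// !mulr0 subrr.
Qed.

Lemma elim_step_factor Y i : 0 < gram Y i i ->
  exists2 S, upper_pos S & Y = elim_step i Y *m S.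
Proof.
set d := gram Y i i => d0.
(* Inverse of the column operation: column [k] of [Y] is [d^-1] times the new column plus
   [gram Y i k / d] times column [i]. *)
pose S : 'M[R]_n := \matrix_(j, k) if (i < k)%N then
  (if j == k then d^-1 else if j == i then gram Y i k / d else 0)
  else (j == k)%:R.
exists S.
  apply/upper_posP; split=> [j k kj|j]; rewrite mxE ?eqxx; last first.
    by case: ifP => // _; rewrite invr_gt0.
  have -> : j == k = false by apply/negbTE; rewrite neq_ltn kj orbT.
  case: ifP => // ik; have -> // : j == i = false.
  by apply/negbTE; rewrite neq_ltn (ltn_trans ik kj) orbT.
apply/matrixP => r k; rewrite mxE (bigD1 k)//= !mxE eqxx.
case: ifPn => ik; last first.
  rewrite big1 ?mulr1 ?addr0// => j jk.
  by rewrite !mxE (negbTE ik) (negbTE jk) mulr0.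
have ik' : i != k by rewrite neq_ltn ik.
rewrite (bigD1 i)//= !mxE ltnn ik (negbTE ik') eqxx big1 ?addr0; last first.
  by move=> j /andP[jk ji]; rewrite !mxE ik (negbTE jk) (negbTE ji) mulr0.
by rewrite -/d; field; rewrite gt_eqF.
Qed.

Lemma gram_ge0 Y i : 0 <= gram Y i i.
Proof. by apply: sumr_ge0 => r _; rewrite -expr2 sqr_ge0. Qed.

Definition elim_pivot X i := gram (elim X n) i i.

(** Each step is undone by an upper triangular factor: its pivot is a sum of squares, so being
    nonzero makes it positive. *)
Lemma elim_factor X m : (forall i, elim_pivot X i != 0) ->
  exists2 S, upper_pos S & X = elim X m *m S.
Proof.
move=> pX; elim: m => [|m [S uS XS]].
  by exists 1%:M; [exact: upper_pos1|rewrite mulmx1].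
rewrite /=; case: insubP => [i _ im|_] /=; last by exists S.
have d0 : 0 < gram (elim X m) i i.
  rewrite lt_neqAle gram_ge0 andbT eq_sym -im.
  by have := pX i; rewrite /elim_pivot gram_elim_frozen// ltnW.
have [T uT YT] := elim_step_factor d0.
by exists (T *m S); [exact: upper_pos_mul|rewrite mulmxA -YT].
Qed.

(** Column [i] of [V *m S] is [S i i] times that of [V]. On expanding column [k], the terms [l < i]
    vanish through [S l k] and the terms [l > i] through [gram V i l]. *)
Lemma gram_mul V S i k : (forall j l, (j <= l)%N -> gram V j l = (j == l)%:R) ->
    (forall l, (l < i)%N -> S l k = 0) -> (forall l, l != i -> S l i = 0) ->
  gram (V *m S) i k = S i i * S i k.
Proof.
move=> gV Sk Si.
have VSi r : (V *m S) r i = V r i * S i i.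
  rewrite mxE (bigD1 i)//= big1 ?addr0// => l li.
  by rewrite Si// mulr0.
transitivity (S i i * \sum_l gram V i l * S l k).
  rewrite {1}/gram mulr_sumr.
  under [RHS]eq_bigr do rewrite mulr_suml mulr_sumr.
  rewrite [RHS]exchange_big/=; apply: eq_bigr => r _.
  rewrite VSi mxE mulr_sumr; apply: eq_bigr => l _; ring.
rewrite (bigD1 i)//= gV// eqxx mul1r big1 ?addr0// => l li.
have [lti|il] := ltnP l i; first by rewrite Sk// mulr0.
by rewrite gV// eq_sym (negbTE li) mul0r.
Qed.

(** The elimination of [V *m S0] acts on the coefficients alone, and after [m] steps the first [m]
    rows of [S] are reduced to their diagonal entries. With [m = n], the resulting columns are
    positive multiples of those of [V]. *)
Lemma elim_mul V S0 m : (forall i k, (i <= k)%N -> gram V i k = (i == k)%:R) ->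
    upper_pos S0 ->
  exists S, [/\ upper_pos S, (forall i k, (i < m)%N -> k != i -> S i k = 0) &
    elim (V *m S0) m = V *m S].
Proof.
move=> gV uS0; elim: m => [|m [S [uS dS ES]]]; first by exists S0.
rewrite /=; case: insubP => [i _ im|ni] /=; last first.
  exists S; split=> // i k im; apply: dS.
  by move: ni; rewrite -leqNgt; apply: leq_trans.
have [S0' Sp] := (upper_posP _).1 uS.
have Si l : l != i -> S l i = 0.
  move=> li; have [lti|il] := ltnP l i.
    by rewrite dS -?im// eq_sym.
  by rewrite S0'// ltn_neqAle eq_sym li.
have gS k : (i <= k)%N -> gram (elim (V *m S0) m) i k = S i i * S i k.
  move=> ik; rewrite ES; apply: gram_mul => // l li.
  rewrite dS -?im//; apply: contraTneq li => <-.
  by rewrite -leqNgt.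
(* The column operation of step [i], transferred to [S] by the values [gS]. It clears row [i] right
   of the diagonal and only rescales entries of the other rows, since [S l i = 0] there. *)
pose S' : 'M[R]_n := \matrix_(l, k) if (i < k)%N then
  S i i * S i i * S l k - S i i * S i k * S l i else S l k.
exists S'; split.
- apply/upper_posP; split=> [l k kl|l]; rewrite !mxE; case: ifP => // il.
  + rewrite (S0' _ _ kl) (Si l) ?mulr0 ?mulr0 ?subrr//.
    by rewrite neq_ltn (ltn_trans il kl) orbT.
  + exact: S0'.
  + have li : l != i by rewrite neq_ltn il orbT.
    by rewrite (Si l li) mulr0 subr0 !mulr_gt0.
- move=> l k; rewrite ltnS leq_eqVlt => /orP[/eqP lm|lm] kl.
    have {}lm : l = i by apply: val_inj; rewrite /= lm -im.
    rewrite mxE lm; case: ifPn => ik; first by ring.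
    by rewrite S0'// ltn_neqAle -[X in _ != val X]lm kl leqNgt.
  have li : (l < i)%N by rewrite im.
  rewrite mxE (dS l k)// (Si l) ?mulr0 ?subr0; last by rewrite neq_ltn li.
  by case: ifP.
- apply/matrixP => r k; rewrite !mxE; case: ifPn => ik; last first.
    rewrite ES mxE; apply: eq_bigr => l _; by rewrite mxE (negbTE ik).
  rewrite !gS// 1?ltnW// ES !mxE !mulr_sumr -sumrB.
  apply: eq_bigr => l _; rewrite mxE ik; ring.
Qed.

End Elimination.

(** * The factors of a matrix and their uniqueness *)

Section Factorization.
Context {R : realType} {n : nat}.
Variable lam : 'rV[R]_n.
Implicit Types (X Y Q L U V : 'M[R]_n) (i j k l r : 'I_n).

Lemma U_posP U : U_pos U <-> upper_pos U /\ \det U = 1.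
Proof. by split=> [[]|[[]]]. Qed.

Lemma L_diagP L : L_diag lam L <->
  [/\ (forall i j, (i < j)%N -> L i j = 0), (forall i, L i i = 1) &
      (forall i j, lam 0 i = lam 0 j -> i != j -> L i j = 0)].
Proof. by split=> -[tL L1 L0]; split=> //; apply/is_trig_mxP. Qed.

Lemma det_L_diag L : L_diag lam L -> \det L = 1.
Proof.
by move=> [tL L1 _]; rewrite det_trig// big1// => i _; rewrite L1.
Qed.

Lemma comm_diag_mxP X :
  X *m diag_mx lam = diag_mx lam *m X <->
  (forall i j, lam 0 i != lam 0 j -> X i j = 0).
Proof.
split=> [XD i j ij|X0].
  move/matrixP/(_ i j): XD; rewrite mul_diag_mx mul_mx_diag !mxE mulrC => /eqP.
  rewrite -subr_eq0 -mulrBl mulf_eq0 subr_eq0 eq_sym (negbTE ij) /=.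
  by move/eqP.
apply/matrixP => i j; rewrite mul_diag_mx mul_mx_diag !mxE.
have [->|/X0 ->] := eqVneq (lam 0 i) (lam 0 j); first by rewrite mulrC.
by rewrite mulr0 mul0r.
Qed.

Lemma SO_diagP Q : SO_diag lam Q <-> [/\ Q^T *m Q = 1%:M, \det Q = 1 &
  forall i j, lam 0 i != lam 0 j -> Q i j = 0].
Proof.
split=> [[[QQ dQ] E]|[QQ dQ /comm_diag_mxP Qc]].
  split=> //; apply/comm_diag_mxP.
  by rewrite -{1}E !mulmxA (mulmx1C QQ) mul1mx.
by split=> //; rewrite -mulmxA -Qc mulmxA QQ mul1mx.
Qed.

Lemma SO_diag1 : SO_diag lam 1%:M.
Proof.
apply/SO_diagP; split; rewrite ?trmx1 ?mulmx1 ?det1// => i j ij.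
by rewrite mxE; case: (eqVneq i j) ij => // ->; rewrite eqxx.
Qed.

Lemma L_diag1 : L_diag lam 1%:M.
Proof.
apply/L_diagP; split=> [i j ij|i|i j _ ij]; rewrite mxE ?eqxx ?(negbTE ij)//.
by rewrite -val_eqE/= ltn_eqF.
Qed.

Lemma U_pos1 : @U_pos R n 1%:M.
Proof. by apply/U_posP; split; [exact: upper_pos1|rewrite det1]. Qed.

Definition factorV X : 'M[R]_n :=
  \matrix_(r, i) (elim lam X n r i * (Num.sqrt (elim_pivot lam X i))^-1).

Definition factorQ X : 'M[R]_n :=
  \matrix_(r, i) if lam 0 r == lam 0 i then factorV X r i else 0.

Definition factorL X := (factorQ X)^T *m factorV X.

(** [\adj] serves as inverse because [factorL X] has determinant one on factorable matrices; being
    polynomial in the entries, it makes smoothness immediate. *)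
Definition factorU X := \adj (factorL X) *m ((factorQ X)^T *m X).

Definition factorable X := forall i, elim_pivot lam X i != 0.

Lemma elim_pivot_gt0 X i : factorable X -> 0 < elim_pivot lam X i.
Proof. by move=> fX; rewrite lt_neqAle gram_ge0 andbT eq_sym fX. Qed.

Lemma gram_factorV X i k : factorable X -> (i <= k)%N ->
  gram lam (factorV X) i k = (i == k)%:R.
Proof.
move=> fX ik.
have -> : gram lam (factorV X) i k = gram lam (elim lam X n) i k *
    ((Num.sqrt (elim_pivot lam X i))^-1 * (Num.sqrt (elim_pivot lam X k))^-1).
  by rewrite {1}/gram mulr_suml; apply: eq_bigr => r _; rewrite !mxE; ring.
have [<-|neik] := eqVneq i k.
  rewrite -invfM -expr2 sqr_sqrtr; last exact/ltW/elim_pivot_gt0.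
  by rewrite (mulfV (fX i)).
by rewrite gram_elim0 ?mul0r// ltn_neqAle ik andbT.
Qed.

(** Column [i] of [factorQ] keeps exactly the rows in the class of [i], so the product sums over
    that class only. *)
Lemma factorLE X i k : factorL X i k = gram lam (factorV X) i k.
Proof.
rewrite /factorL mxE /gram [RHS]big_mkcond/=; apply: eq_bigr => r _.
by rewrite !mxE; case: ifP => // _; rewrite mul0r.
Qed.

(** Columns of the same class have the partial inner products of [factorV]; columns of different
    classes have disjoint supports. Since [gram_factorV] covers [i <= k] only, the other entries
    come from the symmetry of the product. *)
Lemma factorQ_orth X : factorable X -> (factorQ X)^T *m factorQ X = 1%:M.
Proof.
move=> fX; have le i k : (i <= k)%N ->
    ((factorQ X)^T *m factorQ X) i k = (i == k)%:R.
  move=> ik; have [lik|lik] := eqVneq (lam 0 i) (lam 0 k).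
    rewrite -(gram_factorV fX ik) -factorLE /factorL !mxE.
    apply: eq_bigr => r _; rewrite !mxE lik.
    by case: ifP => // _; rewrite !mul0r.
  rewrite mxE big1 => [|r _].
    by case: (eqVneq i k) lik => // ->; rewrite eqxx.
  rewrite !mxE; case: eqVneq => [->|]; last by rewrite mul0r.
  by rewrite (negbTE lik) mulr0.
apply/matrixP => i k; rewrite [RHS]mxE.
have [|/ltnW ki] := leqP i k; first exact: le.
have GT : ((factorQ X)^T *m factorQ X)^T = (factorQ X)^T *m factorQ X.
  by rewrite trmx_mul trmxK.
by rewrite eq_sym -le// -[in LHS]GT mxE.
Qed.

Lemma factorL_L_diag X : factorable X -> L_diag lam (factorL X).
Proof.
move=> fX; apply/L_diagP; split.
- move=> i j ij; rewrite factorLE (gram_factorV fX (ltnW ij)).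
  by rewrite -val_eqE /= ltn_eqF.
- by move=> i; rewrite factorLE (gram_factorV fX (leqnn i)) eqxx.
(* On the rows in the class of [i], which contains [j], the columns [j] of [factorV] and [factorQ]
   agree. *)
move=> i j lij ij; transitivity (((factorQ X)^T *m factorQ X) i j).
  rewrite !mxE; apply: eq_bigr => r _; rewrite !mxE lij.
  by case: ifP => // _; rewrite !mul0r.
by rewrite factorQ_orth// mxE (negbTE ij).
Qed.

Lemma mul_factorQLU X : factorable X ->
  factorQ X *m factorL X *m factorU X = X.
Proof.
move=> fX; rewrite /factorU 2!mulmxA -(mulmxA _ (factorL X)) mul_mx_adj.
by rewrite det_L_diag ?mulmx1 ?mulmxA ?(mulmx1C (factorQ_orth fX)) ?mul1mx//;
   exact: factorL_L_diag.
Qed.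

(** Rescaling the columns in [elim_factor] gives [X = V D S], with [D] the diagonal matrix of the
    square roots of the pivots; as [Q^T V = L], the factor [U] is [D S]. *)
Lemma factorU_upper_pos X : factorable X -> upper_pos (factorU X).
Proof.
move=> fX; have [S uS XS] := elim_factor n fX.
pose d := \row_i Num.sqrt (elim_pivot lam X i).
have d_gt0 i : 0 < d 0 i by rewrite mxE sqrtr_gt0 elim_pivot_gt0.
have VX : X = factorV X *m (diag_mx d *m S).
  rewrite mulmxA [LHS]XS; congr (_ *m _).
  apply/matrixP => r i; rewrite mul_mx_diag mxE -[LHS]mulr1.
  rewrite [factorV X r i]mxE [d 0 i]mxE -mulrA mulVf//.
  by have := d_gt0 i; rewrite mxE => /gt_eqF ->.
suff -> : factorU X = diag_mx d *m S.
  apply: upper_pos_mul => //; apply/upper_posP; split=> [i j ji|i].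
    by rewrite mxE -val_eqE /= gtn_eqF.
  by rewrite mxE eqxx mulr1n.
have QX : (factorQ X)^T *m X = factorL X *m (diag_mx d *m S).
  by rewrite {2}VX mulmxA.
rewrite /factorU QX mulmxA mul_adj_mx det_L_diag ?mul1mx//.
exact: factorL_L_diag.
Qed.

Lemma factor_mem X : SL X -> factorable X ->
  [/\ SO_diag lam (factorQ X), L_diag lam (factorL X) & U_pos (factorU X)].
Proof.
move=> dX fX; have dL := det_L_diag (factorL_L_diag fX).
have dU := det_upper_pos (factorU_upper_pos fX).
have dQU : \det (factorQ X) * \det (factorU X) = 1.
  have := congr1 determinant (mul_factorQLU fX).
  by rewrite 2!det_mulmx dL mulr1 dX.
(* Orthogonality leaves the sign open; [det Q * det U = 1] with [det U > 0] excludes -1. *)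
have dQ : \det (factorQ X) = 1.
  have /(congr1 determinant) := factorQ_orth fX.
  rewrite det_mulmx det_tr det1 -expr2 => /eqP.
  rewrite sqrf_eq1 => /orP[/eqP //|/eqP dQ].
  by move: dU; rewrite -(ltr_nM2l (ltrN10 R)) -dQ dQU dQ mulr0 ltr10.
split; [|exact: factorL_L_diag|].
  apply/SO_diagP; split=> // [|i j ij]; first exact: factorQ_orth.
  by rewrite mxE (negbTE ij).
apply/U_posP; split; first exact: factorU_upper_pos.
by rewrite -dQU dQ mul1r.
Qed.

(** [Q r l] vanishes unless [l] is in the class of [r], where [L l i] vanishes for [l] other than
    [i]. Hence truncating [Q *m L] to the classes returns [Q]. *)
Lemma SO_L_same Q L i r : SO_diag lam Q -> L_diag lam L ->
  lam 0 r = lam 0 i -> (Q *m L) r i = Q r i.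
Proof.
move=> /SO_diagP[_ _ Q0] /L_diagP[_ L1 L0] ri.
rewrite mxE (bigD1 i)//= L1 mulr1 big1 ?addr0// => l li.
have [lli|lli] := eqVneq (lam 0 l) (lam 0 i); first by rewrite L0// mulr0.
by rewrite Q0 ?mul0r// ri eq_sym.
Qed.

(** The Gram values of [V = Q L] are the entries of [L], so [V] satisfies the normalisation required
    by [elim_mul]. The pivots are then the squares [S i i ^+ 2], and normalising recovers first [V],
    then [Q], [L] and [U]. *)
Lemma factor_unique Q L U : SO_diag lam Q -> L_diag lam L -> U_pos U ->
  [/\ factorable (Q *m L *m U), factorQ (Q *m L *m U) = Q,
      factorL (Q *m L *m U) = L & factorU (Q *m L *m U) = U].
Proof.
move=> hQ hL /U_posP[uU _]; set V := Q *m L; set X := V *m U.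
have [QQ _ Q0] := (SO_diagP _).1 hQ; have [L0 L1 _] := (L_diagP _).1 hL.
have gV i k : gram lam V i k = L i k.
  have -> : L = Q^T *m V by rewrite mulmxA QQ mul1mx.
  rewrite mxE /gram big_mkcond/=; apply: eq_bigr => r _; rewrite [Q^T _ _]mxE.
  case: eqVneq => [ri|ri]; first by rewrite SO_L_same.
  by rewrite Q0// mul0r.
have gV1 i k : (i <= k)%N -> gram lam V i k = (i == k)%:R.
  rewrite gV; have [->|ik] := eqVneq i k; first by rewrite L1.
  by move=> ik'; rewrite L0// ltn_neqAle ik.
have [S [/upper_posP[_ S_gt0] S0 ES]] := elim_mul n gV1 uU.
have WE r i : elim lam X n r i = V r i * S i i.
  rewrite ES mxE (bigD1 i)//= big1 ?addr0// => l li.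
  by rewrite S0 ?mulr0// eq_sym.
have pE i : elim_pivot lam X i = S i i ^+ 2.
  transitivity (gram lam V i i * S i i ^+ 2); last by rewrite gV L1 mul1r.
  rewrite /elim_pivot /gram mulr_suml; apply: eq_bigr => r _.
  by rewrite !WE; ring.
have VE : factorV X = V.
  apply/matrixP => r i; rewrite mxE WE pE sqrtr_sqr gtr0_norm//.
  by rewrite mulfK// gt_eqF.
have QE : factorQ X = Q.
  apply/matrixP => r i; rewrite mxE VE; case: eqVneq => [ri|ri].
    by rewrite /V SO_L_same.
  by rewrite Q0.
have LE : factorL X = L by rewrite /factorL QE VE /V mulmxA QQ mul1mx.
split=> //; first by move=> i; rewrite pE expf_neq0// gt_eqF.
rewrite /factorU LE QE /X /V -!mulmxA (mulmxA Q^T) QQ mul1mx mulmxA mul_adj_mx.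
by rewrite det_L_diag// mul1mx.
Qed.

Lemma SL_prod3 Q L U : SO_diag lam Q -> L_diag lam L -> U_pos U ->
  SL (Q *m L *m U).
Proof.
move=> /SO_diagP[_ dQ _] /det_L_diag dL /U_posP[_ dU].
by rewrite /SL /= !det_mulmx dQ dL dU !mulr1.
Qed.

Lemma image_prod3 : @prod3 R n @` (SO_diag lam `*` L_diag lam `*` @U_pos R n) =
  [set X | SL X /\ factorable X].
Proof.
apply/seteqP; split=> X /=.
  move=> [[[Q L] U]] [[/= hQ hL] hU] <-; rewrite /prod3 /=; split.
    exact: SL_prod3.
  by have [] := factor_unique hQ hL hU.
move=> [dX fX]; have [hQ hL hU] := factor_mem dX fX.
exists (factorQ X, factorL X, factorU X); first by split.
exact: mul_factorQLU.
Qed.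

End Factorization.

(** * Polynomial pivots and smooth dependence of the factors *)

Section SmoothFactorization.
Context {R : realType} {n : nat}.
Variable lam : 'rV[R]_n.
Implicit Types i j k r : 'I_n.

Lemma polynomial_gram (F : 'M[R]_n -> 'M[R]_n) i k :
  (forall r j, polynomial_fun (fun X => F X r j)) ->
  polynomial_fun (fun X => gram lam (F X) i k).
Proof. by move=> pF; apply: polynomial_sum => r; exact: polynomial_mul. Qed.

Lemma polynomial_elim m r k :
  polynomial_fun (fun X => elim lam X m r k).
Proof.
elim: m r k => [|m IH] r k; first exact: polynomial_coord.
rewrite /=; case: insub => [i|] //=.
have [ik|ik] := boolP (i < k)%N; last first.
  by have [p pE] := IH r k; exists p => X; rewrite mxE (negbTE ik).
have [p pE] : polynomial_fun (fun X =>
    gram lam (elim lam X m) i i * elim lam X m r k +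
    -1 * (gram lam (elim lam X m) i k * elim lam X m r i)).
  have pg j : polynomial_fun (fun X => gram lam (elim lam X m) i j).
    exact: polynomial_gram.
  apply: polynomial_add; first exact: polynomial_mul.
  apply: polynomial_mul; first exact: polynomial_cst.
  exact: polynomial_mul.
by exists p => X; rewrite pE mxE ik mulN1r.
Qed.

Lemma polynomial_pivot i :
  polynomial_fun (fun X => elim_pivot lam X i).
Proof. by apply: polynomial_gram => r j; exact: polynomial_elim. Qed.

Lemma factorable_prod (X : 'M[R]_n) :
  factorable lam X <-> \prod_i elim_pivot lam X i != 0.
Proof.
by split=> [fX|/prodf_neq0 fX i]; [apply/prodf_neq0 => i _|]; exact: fX.
Qed.

Lemma polynomial_factorable :
  polynomial_fun (fun X => \prod_i elim_pivot lam X i).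
Proof. by apply: polynomial_prod => i; exact: polynomial_pivot. Qed.

Lemma open_factorable : open [set X | factorable lam X].
Proof.
have -> : [set X | factorable lam X] =
    [set X | setT X /\ \prod_i elim_pivot lam X i != 0].
  apply/seteqP; split=> X /=; first by move/factorable_prod.
  by move=> [_ /factorable_prod].
apply: open_smooth_neq0; first exact: openT.
by apply: smooth_polynomial; [exact: openT|exact: polynomial_factorable].
Qed.

Lemma smooth_factorV : smooth [set X | factorable lam X] (factorV lam).
Proof.
have oO := open_factorable; apply: smooth_matrix => // r i.
apply: smooth_mul => //.
  by apply: smooth_polynomial => //; exact: polynomial_elim.
apply: smooth_inv => //.
  by move=> X fX; rewrite gt_eqF// sqrtr_gt0 elim_pivot_gt0.
apply: smooth_sqrt => //; first by move=> X fX; exact: elim_pivot_gt0.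
by apply: smooth_polynomial => //; exact: polynomial_pivot.
Qed.

Lemma smooth_factorQ : smooth [set X | factorable lam X] (factorQ lam).
Proof.
have oO := open_factorable; apply: smooth_matrix => // r i.
case: (lam 0 r == lam 0 i); last exact: smooth_cst.
by apply: smooth_coord => //; exact: smooth_factorV.
Qed.

Lemma smooth_factorL : smooth [set X | factorable lam X] (factorL lam).
Proof.
have oO := open_factorable.
apply: smooth_mulmx => //; last exact: smooth_factorV.
by apply: smooth_trmx => //; exact: smooth_factorQ.
Qed.

Lemma smooth_factorU : smooth [set X | factorable lam X] (factorU lam).
Proof.
have oO := open_factorable; apply: smooth_mulmx => //.
  by apply: smooth_adj => //; exact: smooth_factorL.
apply: smooth_mulmx => //; last exact: smooth_id.
by apply: smooth_trmx => //; exact: smooth_factorQ.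
Qed.

Lemma diffeomorphism_prod3 :
  diffeomorphism (SO_diag lam `*` L_diag lam `*` @U_pos R n)
    (@prod3 R n @` (SO_diag lam `*` L_diag lam `*` @U_pos R n)) (@prod3 R n).
Proof.
split=> //.
exists (fun X => (factorQ lam X, factorL lam X, factorU lam X)); split.
- move=> [[Q L] U] [[/= hQ hL] hU].
  by rewrite /prod3 /=; have [_ -> -> ->] := factor_unique hQ hL hU.
- apply: (@smooth_smooth_on _ _ _ setT _ _ (@prod3 R n)) => //.
    exact: openT.
  have oT := @openT ('M[R]_n * 'M[R]_n * 'M[R]_n)%type.
  apply: smooth_mulmx => //; last by apply: smooth_snd => //; exact: smooth_id.
  by apply: smooth_mulmx => //; [apply: smooth_fst|apply: smooth_snd] => //;
    apply: smooth_fst => //; exact: smooth_id.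
rewrite image_prod3; have oO := @open_factorable.
(* The factors are smooth on an open set of the space of all matrices, so they are their own
   extensions from the image. *)
apply: (smooth_smooth_on oO) => [X []//||X _]; last by [].
apply: smooth_pair => //; last exact: smooth_factorU.
by apply: smooth_pair => //; [exact: smooth_factorQ|exact: smooth_factorL].
Qed.

End SmoothFactorization.

(** * Charts *)

Section Cayley.
Context {R : realType} {n : nat}.
Implicit Types (A B Q : 'M[R]_n).

Definition cayley A := (1%:M - A) *m invmx (1%:M + A).

Lemma cayley1D A : \det (1%:M + A) != 0 ->
  1%:M + cayley A = 2 *: invmx (1%:M + A).
Proof.
move=> dA; have uA : 1%:M + A \in unitmx by rewrite unitmxE unitfE.
rewrite -{1}(mulmxV uA) -mulmxDl addrACA subrr addr0.
by rewrite -mulr2n -scaler_nat -scalemxAl mul1mx.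
Qed.

Lemma cayley_unit A : \det (1%:M + A) != 0 -> \det (1%:M + cayley A) != 0.
Proof.
move=> dA; rewrite cayley1D// detZ det_inv.
by rewrite mulf_neq0 ?invr_eq0// expf_neq0// pnatr_eq0.
Qed.

(** With [C = cayley A], the identities [1 + C = 2 (1 + A)^-1] and [1 - C = 2 A (1 + A)^-1] give
    [1 - C = A (1 + C)]. *)
Lemma cayleyK A : \det (1%:M + A) != 0 -> cayley (cayley A) = A.
Proof.
move=> dA; have uA : 1%:M + A \in unitmx by rewrite unitmxE unitfE.
have uC : 1%:M + cayley A \in unitmx by rewrite unitmxE unitfE cayley_unit.
apply: (can_inj (mulmxK uC)); rewrite {1}/cayley mulmxKV//.
rewrite cayley1D// -scalemxAr.
rewrite -{1}(mulmxV uA) -mulmxBl opprB [A - _]addrC addrACA subrr add0r.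
by rewrite -mulr2n -scaler_nat -scalemxAl.
Qed.

(** The number [v A v^T] equals its opposite, so [v (1 + A) = 0] implies [v v^T = 0]. *)
Lemma det_skew1D A : A^T = - A -> \det (1%:M + A) != 0.
Proof.
move=> skA; apply/negP => /det0P[v v0 vA].
have vAv : v *m A *m v^T = 0.
  apply/matrixP => i j; rewrite !ord1 [RHS]mxE.
  have : (v *m A *m v^T)^T = - (v *m A *m v^T).
    by rewrite !trmx_mul trmxK skA mulNmx mulmxN mulmxA.
  move=> /matrixP/(_ 0 0); rewrite !mxE => /eqP.
  by rewrite -addr_eq0 -mulr2n mulrn_eq0 /= => /eqP.
have vv : v *m v^T = 0.
  have : v *m (1%:M + A) *m v^T = 0 by rewrite vA mul0mx.
  by rewrite mulmxDr mulmx1 mulmxDl vAv addr0.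
move/negP: v0; apply; apply/eqP/rowP => i; rewrite mxE.
move/matrixP/(_ 0 0): vv; rewrite !mxE => /eqP.
rewrite psumr_eq0; last by move=> k _; rewrite mxE -expr2 sqr_ge0.
by move=> /allP/(_ i (mem_index_enum i)); rewrite mxE mulf_eq0 orbb => /eqP.
Qed.

(** With [B = 1 + A], skewness gives [cayley A = B^T B^-1], and [B] commutes with [B^T]. *)
Lemma cayley_orth A : A^T = - A -> (cayley A)^T *m cayley A = 1%:M.
Proof.
move=> skA; have dA := det_skew1D skA.
have uA : 1%:M + A \in unitmx by rewrite unitmxE unitfE.
have BT : (1%:M + A)^T = 1%:M - A by rewrite linearD /= trmx1 skA.
rewrite /cayley -BT; set B := 1%:M + A in uA BT *.
have uBT : B^T \in unitmx by rewrite unitmx_tr.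
rewrite trmx_mul trmxK trmx_inv mulmxA -(mulmxA _ B).
have -> : B *m B^T = B^T *m B.
  rewrite BT [LHS]mulmxDl [RHS]mulmxDr mul1mx !mulmx1 mulmxBr mulmx1.
  by rewrite mulmxBl mul1mx.
by rewrite mulKmx// mulmxV.
Qed.

Lemma det_cayley A : A^T = - A -> \det (cayley A) = 1.
Proof.
move=> skA; have dA := det_skew1D skA.
have BT : (1%:M + A)^T = 1%:M - A by rewrite linearD /= trmx1 skA.
by rewrite /cayley -BT det_mulmx det_tr det_inv mulfV.
Qed.

(** Multiplying by [(1 + Q)^T] on the left and [1 + Q] on the right turns the claim into
    [(1 - Q)^T (1 + Q) = - (1 + Q)^T (1 - Q)]; by [Q^T Q = 1] both sides are [Q - Q^T]. *)
Lemma cayley_skew Q : Q^T *m Q = 1%:M -> \det (1%:M + Q) != 0 ->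
  (cayley Q)^T = - cayley Q.
Proof.
move=> QQ dQ; have uQ : 1%:M + Q \in unitmx by rewrite unitmxE unitfE.
have uQT : (1%:M + Q)^T \in unitmx by rewrite unitmx_tr.
apply: (can_inj (mulKmx uQT)); apply: (can_inj (mulmxK uQ)).
rewrite /cayley trmx_mul trmx_inv mulKVmx// mulmxN mulNmx -mulmxA mulmxKV//.
rewrite !linearD /= linearN /= trmx1.
rewrite !mulmx1 mulmxBl mul1mx QQ mulmxN opprK mulmxDl mul1mx QQ.
by rewrite addrC subrKA [RHS]addrC addrKA.
Qed.

Lemma cayley0 : cayley 0 = 1%:M.
Proof. by rewrite /cayley subr0 addr0 invmx1 mulmx1. Qed.

Lemma cayley1 : cayley 1%:M = 0.
Proof. by rewrite /cayley subrr mul0mx. Qed.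

Lemma det1D1 : \det (1%:M + 1%:M : 'M[R]_n) != 0.
Proof.
by rewrite -mulr2n -scaler_nat detZ det1 mulr1 expf_neq0// pnatr_eq0.
Qed.

(** Used with a diagonal [B], to pass the block structure from a matrix to its Cayley transform. *)
Lemma cayley_comm A B : \det (1%:M + A) != 0 ->
  A *m B = B *m A -> cayley A *m B = B *m cayley A.
Proof.
move=> dA AB; have uA : 1%:M + A \in unitmx by rewrite unitmxE unitfE.
apply: (can_inj (mulmxK uA)); rewrite /cayley -!mulmxA mulVmx// mulmx1.
have -> : B *m (1%:M + A) = (1%:M + A) *m B.
  by rewrite mulmxDr mulmxDl AB mulmx1 mul1mx.
by rewrite mulKmx// mulmxBr mulmxBl AB mulmx1 mul1mx.
Qed.

Lemma smooth_cayley (V : normedModType R) (O : set V) (F : V -> 'M[R]_n) :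
  open O -> (forall x, O x -> \det (1%:M + F x) != 0) ->
  smooth O F -> smooth O (fun x => cayley (F x)).
Proof.
move=> oO dF sF; apply: smooth_mulmx => //.
  have -> : (fun x => 1%:M - F x) = fun x => 1%:M + (-1)%:M *m F x.
    by apply/funext => x; rewrite mul_scalar_mx scaleN1r.
  apply: smooth_add => //; first exact: smooth_cst.
  by apply: smooth_mulmx => //; exact: smooth_cst.
by apply: smooth_invmx => //; apply: smooth_add => //; exact: smooth_cst.
Qed.

End Cayley.

(** * The charts of SL(n) and their inverses *)

Section Charts.
Context {R : realType} {n : nat}.
Variable lam : 'rV[R]_n.
Implicit Types (X Y Q L U : 'M[R]_n) (i j k : 'I_n).

Definition is_last i := (i.+1 == n)%N.

Lemma is_last_inj i j : is_last i -> is_last j -> i = j.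
Proof.
by move=> /eqP hi /eqP hj; apply: val_inj; apply: succn_inj; rewrite hi.
Qed.

(** One matrix [Y] stores all parameters: its strictly lower entries within a class determine [Q],
    the other strictly lower ones [L], and those on and above the diagonal [U]. *)
Definition skew_part Y : 'M[R]_n := \matrix_(i, j)
  if lam 0 i == lam 0 j then
    if (j < i)%N then Y i j else if (i < j)%N then - Y j i else 0
  else 0.

Definition paramQ Q0 Y := Q0 *m cayley (skew_part Y).

Definition paramL Y : 'M[R]_n := \matrix_(i, j)
  if (j < i)%N && (lam 0 i != lam 0 j) then Y i j else (i == j)%:R.

(* The last diagonal entry is the one which makes the determinant equal to 1. *)
Definition paramU Y : 'M[R]_n := \matrix_(i, j)
  if (i < j)%N then Y i j else if i == j then
    if is_last i then \prod_(k | k != i) (1 + Y k k)^-1 else 1 + Y i i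
  else 0.

Definition param Q0 Y := paramQ Q0 Y *m paramL Y *m paramU Y.

Definition param_dom Y := forall i, ~~ is_last i -> 0 < 1 + Y i i.

(** Multiplication by [Q0^T] moves the centre [Q0] to the identity, near which the Cayley transform
    is defined. *)
Definition chart_dom Q0 X :=
  factorable lam X /\ \det (1%:M + Q0^T *m factorQ lam X) != 0.

(** The factors [Q = Q0], [L = 1] and [U = 1] have zero coordinates, so that each factor becomes a
    slice. *)
Definition chart Q0 X : 'M[R]_n := \matrix_(i, j)
  if (j < i)%N then
    if lam 0 i == lam 0 j then cayley (Q0^T *m factorQ lam X) i j
    else factorL lam X i j
  else factorU lam X i j - (i == j)%:R.

Lemma skew_part_skew Y : (skew_part Y)^T = - skew_part Y.
Proof.
apply/matrixP => i j; rewrite !mxE eq_sym.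
case: (lam 0 i == lam 0 j); last by rewrite oppr0.
by case: ltngtP => _; rewrite ?opprK ?oppr0.
Qed.

Lemma SO_diag_cayley Q0 A : SO_diag lam Q0 -> A^T = - A ->
  (forall i j, lam 0 i != lam 0 j -> A i j = 0) ->
  SO_diag lam (Q0 *m cayley A).
Proof.
move=> /SO_diagP[QQ dQ /comm_diag_mxP Q0c] skA /comm_diag_mxP Ac.
apply/SO_diagP; split.
- by rewrite trmx_mul mulmxA -(mulmxA _ Q0^T) QQ mulmx1 cayley_orth.
- by rewrite det_mulmx dQ det_cayley// mul1r.
apply/comm_diag_mxP.
by rewrite -mulmxA cayley_comm ?det_skew1D// !mulmxA Q0c.
Qed.

Lemma paramQ_SO Q0 Y : SO_diag lam Q0 -> SO_diag lam (paramQ Q0 Y).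
Proof.
move=> hQ0; apply: SO_diag_cayley => //; first exact: skew_part_skew.
by move=> i j ij; rewrite mxE (negbTE ij).
Qed.

Lemma paramL_L Y : L_diag lam (paramL Y).
Proof.
apply/L_diagP; split=> [i j ij|i|i j lij ij]; rewrite mxE.
- by rewrite ltnNge ltnW//= -val_eqE /= ltn_eqF.
- by rewrite ltnn /= eqxx.
- by rewrite lij eqxx andbF (negbTE ij).
Qed.

Lemma paramU_U Y : param_dom Y -> U_pos (paramU Y).
Proof.
move=> dY.
have uU : upper_pos (paramU Y).
  apply/upper_posP; split=> [i j ji|i]; rewrite mxE ?ltnn ?eqxx.
    by rewrite ltnNge ltnW//= -val_eqE /= gtn_eqF.
  case: ifPn => li; last exact: dY.
  apply: prodr_gt0 => k ki; rewrite invr_gt0; apply: dY.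
  by apply: contraNN ki => lk; rewrite (is_last_inj lk li).
apply/U_posP; split=> //; have [tU _] := uU.
rewrite -det_tr det_trig//.
have [n0|n0] := posnP n.
  by rewrite big1// => i; have := ltn_ord i; rewrite {2}n0.
have n1 : (n.-1 < n)%N by rewrite ltn_predL.
pose i0 : 'I_n := Ordinal n1.
have li0 : is_last i0 by rewrite /is_last /= prednK.
rewrite (bigD1 i0)//= !mxE ltnn eqxx li0 prodfV.
have -> : \prod_(i | i != i0) (paramU Y)^T i i =
    \prod_(i | i != i0) (1 + Y i i).
  apply: eq_bigr => i ii0; rewrite !mxE ltnn eqxx; case: ifP => // li.
  by rewrite (is_last_inj li li0) eqxx in ii0.
rewrite mulVf//; apply/prodf_neq0 => i ii0; rewrite gt_eqF//; apply: dY.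
by apply: contraNN ii0 => li; rewrite (is_last_inj li li0).
Qed.

Lemma param_chart_dom Q0 Y : SO_diag lam Q0 -> param_dom Y ->
  [/\ chart_dom Q0 (param Q0 Y), factorQ lam (param Q0 Y) = paramQ Q0 Y,
      factorL lam (param Q0 Y) = paramL Y &
      factorU lam (param Q0 Y) = paramU Y].
Proof.
move=> hQ0 dY.
have [fX QE LE UE] :=
  factor_unique (paramQ_SO Y hQ0) (paramL_L Y) (paramU_U dY).
split=> //; split=> //; rewrite QE.
have [QQ _ _] := (SO_diagP _ _).1 hQ0.
by rewrite /paramQ mulmxA QQ mul1mx cayley_unit// det_skew1D// skew_part_skew.
Qed.

(** The corner is excluded because [param] ignores it; the chart holds there the value forced by the
    determinant. *)
Lemma chart_param Q0 Y i j : SO_diag lam Q0 -> param_dom Y ->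
  ~~ (is_last i && is_last j) -> chart Q0 (param Q0 Y) i j = Y i j.
Proof.
move=> hQ0 dY ij; have [_ QE LE UE] := param_chart_dom hQ0 dY.
have [QQ _ _] := (SO_diagP _ _).1 hQ0.
have dA := det_skew1D (skew_part_skew Y).
rewrite mxE QE LE UE /paramQ mulmxA QQ mul1mx cayleyK//.
rewrite !mxE; have [ji|ij'|/val_inj eij] := ltngtP j i.
- by case: (lam 0 i == lam 0 j).
- by rewrite -val_eqE /= ltn_eqF// subr0.
move: ij; rewrite eij eqxx andbb => /negbTE ->.
by rewrite addrAC subrr add0r.
Qed.

(** [Y] may take any value in the corner: the last diagonal entry of [U] is recovered from the
    determinant, and the skew matrix from its lower entries within the classes. *)
Lemma param_chart Q0 X Y : SO_diag lam Q0 -> SL X -> chart_dom Q0 X ->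
  (forall i j, ~~ (is_last i && is_last j) -> Y i j = chart Q0 X i j) ->
  param Q0 Y = X.
Proof.
move=> hQ0 dX [fX dC] YE.
have [QQ0 _ Q0b] := (SO_diagP _ _).1 hQ0.
have [hQ hL hU] := factor_mem dX fX.
have [QQ _ Qb] := (SO_diagP _ _).1 hQ.
have [L0 L1 Lb] := (L_diagP _ _).1 hL.
have [uU dU] := (U_posP _).1 hU; have [U0 Up] := (upper_posP _).1 uU.
have nl i j : i != j -> ~~ (is_last i && is_last j).
  by apply: contraNN => /andP[/is_last_inj h /h ->].
set P := Q0^T *m factorQ lam X in dC.
have PP : P^T *m P = 1%:M.
  rewrite trmx_mul trmxK mulmxA -(mulmxA _ Q0) (mulmx1C QQ0) mulmx1.
  exact: QQ.
have skP := cayley_skew PP dC.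
have Pb : forall i j, lam 0 i != lam 0 j -> cayley P i j = 0.
  apply/comm_diag_mxP/cayley_comm => //.
  have Q0c := (comm_diag_mxP _ _).2 Q0b.
  have Qc := (comm_diag_mxP _ _).2 Qb.
  rewrite -mulmxA Qc !mulmxA; congr (_ *m _).
  have /(congr1 trmx) := Q0c; rewrite !trmx_mul tr_diag_mx.
  by move=> ->.
have AE : skew_part Y = cayley P.
  apply/matrixP => i j; rewrite mxE.
  have [lij|/Pb -> //] := eqVneq (lam 0 i) (lam 0 j).
  case: ltngtP => [ji|ij|/val_inj ->].
  - by rewrite YE ?nl ?neq_ltn ?ji ?orbT// mxE ji lij eqxx.
  - rewrite YE ?nl ?neq_ltn ?ij ?orbT// mxE ij lij eqxx -/P.
    by move/matrixP/(_ j i): skP; rewrite [LHS]mxE [RHS]mxE => ->.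
  - move/matrixP/(_ i i): skP; rewrite [LHS]mxE [RHS]mxE => /eqP.
    by rewrite -addr_eq0 -mulr2n mulrn_eq0 /= => /eqP ->.
have LE : paramL Y = factorL lam X.
  apply/matrixP => i j; rewrite mxE; case: ifPn => [/andP[ji lij]|].
    by rewrite YE ?nl ?neq_ltn ?ji ?orbT// mxE ji (negbTE lij).
  rewrite negb_and negbK -leqNgt; have [-> _|ij] := eqVneq i j.
    by rewrite L1.
  case/orP => [ij'|/eqP lij]; last by rewrite Lb.
  by rewrite L0// ltn_neqAle ij' andbT.
have Ud i : ~~ is_last i -> 1 + Y i i = factorU lam X i i.
  by move=> li; rewrite YE ?andbb// mxE ltnn eqxx addrC subrK.
have UE : paramU Y = factorU lam X.
  apply/matrixP => i j; rewrite mxE.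
  case: ltngtP => [ij|ji|/val_inj <-].
  - rewrite YE ?nl ?neq_ltn ?ij// mxE ltnNge ltnW//= -val_eqE /= ltn_eqF//.
    by rewrite subr0.
  - by rewrite -val_eqE /= gtn_eqF// U0.
  rewrite eqxx; case: ifPn => li; last exact: Ud.
  move: dU; rewrite -det_tr det_trig; last by have [] := uU.
  rewrite (bigD1 i)//= mxE prodfV.
  have -> : \prod_(k | k != i) (factorU lam X)^T k k =
      \prod_(k | k != i) (1 + Y k k).
    apply: eq_bigr => k ki; rewrite mxE Ud//.
    by apply: contraNN ki => lk; rewrite (is_last_inj lk li).
  move=> UP; have P0 : \prod_(k | k != i) (1 + Y k k) != 0.
    apply/eqP => E; move: UP; rewrite E mulr0 => /eqP.
    by rewrite eq_sym oner_eq0.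
  by apply: (mulIf P0); rewrite mulVf// UP.
rewrite /param /paramQ AE LE UE cayleyK// /P (mulmxA Q0) (mulmx1C QQ0) mul1mx.
exact: mul_factorQLU.
Qed.

Lemma chart_in_dom Q0 X Y : SL X -> chart_dom Q0 X ->
  (forall i j, ~~ (is_last i && is_last j) -> Y i j = chart Q0 X i j) ->
  param_dom Y.
Proof.
move=> dX [fX _] YE i li; rewrite YE ?andbb// mxE ltnn eqxx addrC subrK.
by have [_ ->] := (upper_posP _).1 (factorU_upper_pos fX).
Qed.

End Charts.

(** * Matrix entries as coordinates of a row vector *)

Section Coordinates.
Context {R : realType} {n : nat}.
Variable K : pred ('I_n * 'I_n).

Definition free_entry (p : 'I_n * 'I_n) := ~~ (is_last p.1 && is_last p.2).

Definition dim_slice := size (enum [pred p | free_entry p && K p]).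

(** Listing the entries in [K] first turns the vanishing of the others into membership in a slice.
    The corner is left out, so the length is the dimension of SL(n). *)
Definition entries := enum [pred p | free_entry p && K p] ++
  enum [pred p | free_entry p && ~~ K p].

Definition coords (Y : 'M[R]_n) : 'rV[R]_(size entries) :=
  \row_k Y (tnth (in_tuple entries) k).1 (tnth (in_tuple entries) k).2.

(** The corner is absent from [entries], so its index is out of range and it receives the default
    value 0. *)
Definition uncoords (v : 'rV[R]_(size entries)) : 'M[R]_n :=
  \matrix_(i, j) oapp (v 0) 0 (insub (index (i, j) entries)).

Lemma mem_entries p : (p \in entries) = free_entry p.
Proof. by rewrite mem_cat !mem_enum !inE -andb_orr orbN andbT. Qed.

Lemma uniq_entries : uniq entries.
Proof.
rewrite cat_uniq !enum_uniq andbT /=; apply/hasPn => p.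
by rewrite !mem_enum !inE => /andP[_ /negbTE ->]; rewrite andbF.
Qed.

Lemma coordsK v : coords (uncoords v) = v.
Proof.
apply/rowP => k; rewrite !mxE -surjective_pairing.
rewrite (tnth_nth (tnth (in_tuple entries) k)).
by rewrite index_uniq ?uniq_entries// valK.
Qed.

Lemma uncoordsE Y i j : free_entry (i, j) -> uncoords (coords Y) i j = Y i j.
Proof.
rewrite -mem_entries => ij; rewrite mxE.
case: insubP => [k _ kE|]; last by rewrite index_mem ij.
by rewrite /= mxE (tnth_nth (i, j)) /= kE nth_index.
Qed.

Lemma coords_slice Y : slice dim_slice (coords Y) <->
  (forall i j, free_entry (i, j) -> ~~ K (i, j) -> Y i j = 0).
Proof.
split=> [Ys i j ij Kij|Y0 k dk].
  rewrite -uncoordsE// mxE; case: insubP => [k _ kE|//] /=.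
  apply: Ys; rewrite [X in (_ <= X)%N]kE.
  rewrite index_cat mem_enum inE (negbTE Kij) andbF.
  exact: leq_addr.
rewrite mxE; set p := tnth _ k.
have : p \in enum [pred p | free_entry p && ~~ K p].
  rewrite /p (tnth_nth p) /= nth_cat ltnNge dk /=.
  by apply: mem_nth; rewrite ltn_subLR// -size_cat; exact: ltn_ord.
by rewrite mem_enum inE => /andP[fp Kp]; rewrite Y0 -?surjective_pairing.
Qed.

End Coordinates.

(** * The three factors as embedded submanifolds *)

Section Submanifolds.
Context {R : realType} {n : nat}.
Variable lam : 'rV[R]_n.
Implicit Types i j k : 'I_n.

Lemma smooth_factorQ_shift (Q0 : 'M[R]_n) : smooth [set X | factorable lam X]
  (fun X => Q0^T *m factorQ lam X).
Proof.
have oO := @open_factorable R n lam; apply: smooth_mulmx => //.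
  exact: smooth_cst.
exact: smooth_factorQ.
Qed.

Lemma open_chart_dom Q0 : open [set X | chart_dom lam Q0 X].
Proof.
have oO := @open_factorable R n lam.
apply: (open_smooth_neq0 oO); apply: smooth_det => //.
by apply: smooth_add => //; [exact: smooth_cst|exact: smooth_factorQ_shift].
Qed.

Lemma smooth_chart Q0 : smooth [set X | chart_dom lam Q0 X] (chart lam Q0).
Proof.
have oO := @open_chart_dom Q0.
have sub : [set X | chart_dom lam Q0 X] `<=` [set X | factorable lam X].
  by move=> X [].
apply: smooth_matrix => // i j; case: (j < i)%N; [case: (_ == _)|].
- apply: smooth_coord => //; apply: smooth_cayley => //; first by move=> X [].
  exact: smooth_sub sub (smooth_factorQ_shift Q0).
- apply: smooth_coord => //; exact: smooth_sub sub (@smooth_factorL _ _ _).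
- apply: smooth_add => //; last exact: smooth_cst.
  apply: smooth_coord => //; exact: smooth_sub sub (@smooth_factorU _ _ _).
Qed.

Lemma smooth_param (V : normedModType R) (O : set V) (F : V -> 'M[R]_n) Q0 :
  open O -> (forall x, O x -> param_dom (F x)) -> smooth O F ->
  smooth O (fun x => param lam Q0 (F x)).
Proof.
move=> oO dF sF.
have sc i j : smooth O (fun x => F x i j) by exact: smooth_coord.
have s1 i j : smooth O (fun x => 1 + F x i j).
  by apply: smooth_add => //; exact: smooth_cst.
apply: smooth_mulmx => //; first apply: smooth_mulmx => //.
- apply: smooth_mulmx => //; first exact: smooth_cst.
  apply: smooth_cayley => // [x _|]; first exact/det_skew1D/skew_part_skew.
  apply: smooth_matrix => // i j.
  case: (_ == _); last exact: smooth_cst.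
  case: (j < i)%N => //; case: (i < j)%N; last exact: smooth_cst.
  have -> : (fun x => - F x j i) = fun x => -1 * F x j i.
    by apply/funext => x; rewrite mulN1r.
  by apply: smooth_mul => //; exact: smooth_cst.
- apply: smooth_matrix => // i j.
  by case: (_ && _) => //; exact: smooth_cst.
apply: smooth_matrix => // i j.
case: (i < j)%N => //; case: (i == j); last exact: smooth_cst.
case: (boolP (is_last i)) => // li.
apply: smooth_prod => // k ki; apply: smooth_inv => // x Ox.
rewrite gt_eqF//; apply: dF => //.
by apply: contraNN ki => lk; rewrite (is_last_inj lk li).
Qed.

Lemma smooth_coords (V : normedModType R) (O : set V) (F : V -> 'M[R]_n)
    (K : pred ('I_n * 'I_n)) :
  open O -> smooth O F -> smooth O (fun x => coords K (F x)).
Proof.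
by move=> oO sF; apply: smooth_matrix => // _ k; exact: smooth_coord.
Qed.

Lemma smooth_uncoords (V : normedModType R) (O : set V) (K : pred ('I_n * 'I_n))
    (F : V -> 'rV[R]_(size (entries K))) :
  open O -> smooth O F -> smooth O (fun x => uncoords (F x)).
Proof.
move=> oO sF; apply: smooth_matrix => // i j.
by case: insub => [k|] /=; [exact: smooth_coord|exact: smooth_cst].
Qed.

Lemma open_param_dom (K : pred ('I_n * 'I_n)) :
  open [set v : 'rV[R]_(size (entries K)) | param_dom (uncoords v)].
Proof.
rewrite openE => v dv; rewrite /interior /=.
near=> w; move=> i; move: i; near: w; apply: filter_forall => /= i.
case: (boolP (is_last i)) => li; first by near=> w.
have oT := @openT ('rV[R]_(size (entries K))).
have sT : smooth setT (fun w : 'rV[R]_(size (entries K)) => 1 + uncoords w i i).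
  apply: smooth_add => //; first exact: smooth_cst.
  apply: smooth_coord => //; apply: smooth_uncoords => //; exact: smooth_id.
near=> w => _; near: w; apply: (sT 0%N v I [set z | 0 < z]).
by apply: open_nbhs_nbhs; split; [exact: open_gt|exact: dv].
Unshelve. all: by end_near. Qed.

(* K is the set of entries of [chart] which serve as coordinates on S. *)
Lemma embedded_submanifold_chart (S : set 'M[R]_n) (K : pred ('I_n * 'I_n)) :
  S `<=` @SL R n ->
  (forall x, S x -> exists Q0, [/\ SO_diag lam Q0, chart_dom lam Q0 x,
    (forall y i j, S y -> ~~ K (i, j) -> chart lam Q0 y i j = 0) &
    (forall Y, param_dom Y ->
      (forall i j, free_entry (i, j) -> ~~ K (i, j) -> Y i j = 0) ->
      S (param lam Q0 Y))]) ->
  embedded_submanifold (@SL R n) S.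
Proof.
move=> S_SL HS; split=> //; exists (size (entries K)), (dim_slice K); split.
  by rewrite size_cat leq_addr.
move=> x /HS[Q0 [hQ0 dx S0 SP]].
pose O := [set X | chart_dom lam Q0 X].
pose W := [set v : 'rV[R]_(size (entries K)) | param_dom (uncoords v)].
pose phi X := coords K (chart lam Q0 X).
have phiE X i j : free_entry (i, j) ->
    uncoords (phi X) i j = chart lam Q0 X i j.
  exact: uncoordsE.
have phiW X : SL X -> O X -> W (phi X).
  by move=> dX OX; exact: (chart_in_dom dX OX (phiE X)).
have phiK X : SL X -> O X -> param lam Q0 (uncoords (phi X)) = X.
  by move=> dX OX; exact: (param_chart hQ0 dX OX (phiE X)).
have paramM v : W v -> (@SL R n `&` O) (param lam Q0 (uncoords v)).
  move=> Wv; have [Od _ _ _] := param_chart_dom hQ0 Wv; split=> //.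
  apply: (@SL_prod3 _ _ lam); [exact: paramQ_SO|exact: paramL_L|].
  exact: paramU_U.
have paramK v : W v -> phi (param lam Q0 (uncoords v)) = v.
  move=> Wv; rewrite -[RHS]coordsK; apply/rowP => k; rewrite [LHS]mxE [RHS]mxE.
  apply: chart_param => //.
  have := mem_tnth k (in_tuple (entries K)); rewrite /= mem_entries.
  exact.
have imW : phi @` (@SL R n `&` O) = W.
  apply/seteqP; split=> [_ [X [dX OX] <-]|v Wv]; first exact: phiW.
  by exists (param lam Q0 (uncoords v)); [exact: paramM|exact: paramK].
exists O, phi; rewrite imW; split => //.
- exact: open_chart_dom.
- exact: open_param_dom.
- split=> //; exists (fun v => param lam Q0 (uncoords v)); split.
  + by move=> X [dX OX]; exact: phiK.
  + apply: (@smooth_smooth_on _ _ _ O _ phi phi) => //.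
    * exact: open_chart_dom.
    * apply: smooth_coords; [exact: open_chart_dom|exact: smooth_chart].
  + have oW := @open_param_dom K.
    apply: (smooth_smooth_on oW (@subset_refl _ W)) => //.
    apply: smooth_param => //.
    by apply: smooth_uncoords => //; exact: smooth_id.
(* Points of [S] have vanishing coordinates outside [K]; conversely, [SP] places in [S] the image of
   every admissible parameter with this property. *)
apply/seteqP; split=> [_ [X [SX OX] <-]|v [Wv sv]].
  split; first by apply: phiW => //; exact: S_SL.
  by apply/coords_slice => i j _; exact: S0.
exists (param lam Q0 (uncoords v)); last exact: paramK.
split; last by have [] := paramM v Wv.
by apply: SP => //; apply/coords_slice; rewrite coordsK.
Qed.

Lemma paramL1 (Y : 'M[R]_n) :
  (forall i j, (j < i)%N -> lam 0 i != lam 0 j -> Y i j = 0) ->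
  paramL lam Y = 1%:M.
Proof.
move=> Y0; apply/matrixP => i j; rewrite !mxE; case: ifP => // /andP[ji lij].
by rewrite Y0// -val_eqE /= gtn_eqF.
Qed.

Lemma paramU1 (Y : 'M[R]_n) :
  (forall i j, free_entry (i, j) -> (i <= j)%N -> Y i j = 0) -> paramU Y = 1%:M.
Proof.
move=> Y0; apply/matrixP => i j; rewrite !mxE; case: ifPn => [ij|_].
  rewrite Y0 ?(ltnW ij)// -?val_eqE /= ?ltn_eqF//.
  by apply: contraTN ij => /andP[/= hi hj]; rewrite (is_last_inj hi hj) ltnn.
case: eqVneq => [_|//]; case: ifPn => li.
  rewrite big1// => k ki; rewrite Y0// ?addr0 ?invr1// /free_entry /= andbb.
  by apply: contraNN ki => lk; rewrite (is_last_inj lk li).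
by rewrite Y0 ?addr0// /free_entry /= andbb.
Qed.

Lemma paramQ_id Q0 (Y : 'M[R]_n) :
  (forall i j, (j < i)%N -> lam 0 i = lam 0 j -> Y i j = 0) ->
  paramQ lam Q0 Y = Q0.
Proof.
move=> Y0; suff E : skew_part lam Y = 0 by rewrite /paramQ E cayley0 mulmx1.
apply/matrixP => i j; rewrite !mxE; case: eqVneq => // lij.
by case: ltngtP => // h; rewrite Y0 ?oppr0.
Qed.

Lemma free_entry_lt (i j : 'I_n) : (j < i)%N -> free_entry (i, j).
Proof.
move=> ji; apply: contraTN ji => /andP[/= hi hj].
by rewrite (is_last_inj hi hj) ltnn.
Qed.

(** An element of the group factors as [Q * 1 * 1], so in a chart centred at any of its points only
    the Cayley coordinates survive. *)
Lemma embedded_SO_diag : embedded_submanifold (@SL R n) (SO_diag lam).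
Proof.
have fSO Q : SO_diag lam Q -> [/\ factorable lam Q, factorQ lam Q = Q,
    factorL lam Q = 1%:M & factorU lam Q = 1%:M].
  move=> hQ; have := factor_unique hQ (L_diag1 lam) (@U_pos1 _ _).
  by rewrite !mulmx1.
apply: (@embedded_submanifold_chart _
  (fun p => (p.2 < p.1)%N && (lam 0 p.1 == lam 0 p.2))).
  by move=> Q [[]].
move=> Q hQ; exists Q; have [fQ QE _ _] := fSO Q hQ; split=> //.
- split=> //; rewrite QE; have [-> _ _] := (SO_diagP _ _).1 hQ.
  exact: det1D1.
- move=> Q' i j /fSO[_ _ LE UE]; rewrite mxE LE UE !mxE /= => /nandP[ji|lij].
    by rewrite (negbTE ji) subrr.
  rewrite (negbTE lij) subrr; case: ifP => // ji.
  by rewrite -val_eqE /= gtn_eqF.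
move=> Y _ Y0; rewrite /param paramL1 ?paramU1 ?mulmx1.
- exact: paramQ_SO.
- by move=> i j fij ij; apply: Y0 => //=; rewrite ltnNge ij.
- by move=> i j ji lij; apply: Y0; rewrite ?free_entry_lt//= (negbTE lij) andbF.
Qed.

(** Here [Q = 1] throughout, so the chart centred at the identity contains the whole set, and
    [cayley1] makes the Cayley coordinates vanish. *)
Lemma embedded_L_diag : embedded_submanifold (@SL R n) (L_diag lam).
Proof.
have fL L : L_diag lam L -> [/\ factorable lam L, factorQ lam L = 1%:M,
    factorL lam L = L & factorU lam L = 1%:M].
  move=> hL; have := factor_unique (SO_diag1 lam) hL (@U_pos1 _ _).
  by rewrite mul1mx mulmx1.
apply: (@embedded_submanifold_chart _
  (fun p => (p.2 < p.1)%N && (lam 0 p.1 != lam 0 p.2))).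
  by move=> L hL; exact: det_L_diag hL.
move=> L hL; exists 1%:M; have [fL' QE _ _] := fL L hL; split=> //.
- exact: SO_diag1.
- by split=> //; rewrite QE trmx1 mulmx1; exact: det1D1.
- move=> L' i j /fL[_ {}QE LE UE].
  rewrite mxE QE LE UE trmx1 mulmx1 cayley1 !mxE /=.
  by move=> /nandP[/negbTE ->|/negPn ->]; rewrite subrr// if_same.
move=> Y _ Y0; rewrite /param paramQ_id ?paramU1 ?mulmx1 ?mul1mx.
- exact: paramL_L.
- by move=> i j fij ij; apply: Y0 => //=; rewrite ltnNge ij.
- by move=> i j ji lij; apply: Y0; rewrite ?free_entry_lt//= lij eqxx andbF.
Qed.

(** [lam] enters through the chart only. The coordinates are the entries on and above the diagonal,
    the corner excepted. *)
Lemma embedded_U_pos : embedded_submanifold (@SL R n) (@U_pos R n).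
Proof.
have fU U : U_pos U -> [/\ factorable lam U, factorQ lam U = 1%:M,
    factorL lam U = 1%:M & factorU lam U = U].
  move=> hU; have := factor_unique (SO_diag1 lam) (L_diag1 lam) hU.
  by rewrite !mul1mx.
apply: (@embedded_submanifold_chart _ (fun p => (p.1 <= p.2)%N)).
  by move=> U [].
move=> U hU; exists 1%:M; have [fU' QE _ _] := fU U hU; split=> //.
- exact: SO_diag1.
- by split=> //; rewrite QE trmx1 mulmx1; exact: det1D1.
- move=> U' i j /fU[_ {}QE LE _]; rewrite -ltnNge /= => ji.
  rewrite mxE QE LE trmx1 mulmx1 cayley1 ji !mxE -(val_eqE i j) /=.
  by rewrite gtn_eqF// if_same.
move=> Y dY Y0; rewrite /param paramQ_id ?paramL1 ?mul1mx.
- exact: paramU_U.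
- by move=> i j ji lij; apply: Y0; rewrite ?free_entry_lt//= -ltnNge.
- by move=> i j ji lij; apply: Y0; rewrite ?free_entry_lt//= -ltnNge.
Qed.

End Submanifolds.

Theorem theorem2 (R : realType) (n : nat) (lam : 'rV[R]_n)
    (traceless : \tr (diag_mx lam) = 0) :
  let factors := SO_diag lam `*` L_diag lam `*` @U_pos R n in
  let image := @prod3 R n @` factors in
  [/\ [/\ embedded_submanifold (@SL R n) (SO_diag lam),
          embedded_submanifold (@SL R n) (L_diag lam) &
          embedded_submanifold (@SL R n) (@U_pos R n)],
      diffeomorphism factors image (@prod3 R n),
      relatively_open (@SL R n) image &
      exists p : mpoly.mpoly (n * n) R,
        image = [set X | SL X /\ entries_eval p X != 0]].
Proof.
move=> factors image; split.
- split; [exact: embedded_SO_diag|exact: embedded_L_diag|].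
  exact: (embedded_U_pos lam).
- exact: diffeomorphism_prod3.
- exists [set X | factorable lam X]; first exact: open_factorable.
  exact: image_prod3.
have [p pE] := polynomial_factorable lam; exists p.
rewrite /image image_prod3; apply/seteqP; split=> X /= [dX].
  by move/factorable_prod; rewrite pE.
by rewrite pE => /factorable_prod.
Qed.
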